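(* Let $n\ge 0$ be a natural number, $\mathcal{A}=\{1,\dots,n\}$, and $\mathcal{D}_n$ the lattice of antichains over $\mathcal{A}$. Then $$D(n+3)=\sum_{\substack{\alpha\in\mathcal{D}_n\\ \beta_{12},\beta_{13},\beta_{23}\in[\alpha,\top]\\ \gamma\in[\beta_{12}\vee\beta_{13}\vee\beta_{23},\,\top]}}P_3(\alpha,\beta_{12},\beta_{13},\beta_{23})\,|[\bot,\alpha]|\,|[\beta_{12},\gamma]|\,|[\beta_{13},\gamma]|\,|[\beta_{23},\gamma]| ,$$ where $P_3(\alpha,\beta_{12},\beta_{13},\beta_{23})$ is the number of triples $(\chi_1,\chi_2,\chi_3)\in\mathcal{D}_n^3$ satisfying $$\chi_1\wedge\chi_2\wedge\chi_3=\alpha,\quad \chi_1\vee\chi_2=\beta_{12},\quad \chi_1\vee\chi_3=\beta_{13},\quad \chi_2\vee\chi_3=\beta_{23}.$$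
   Context: For $n\ge 0$ let $\mathcal{A}=\{1,\dots,n\}$. An antichain over $\mathcal{A}$ is a set of pairwise non-inclusive subsets of $\mathcal{A}$ (the empty set of subsets $\{\}$ and the singleton $\{\emptyset\}$ are both antichains). $\mathcal{D}_n$ is the set of all antichains over $\mathcal{A}$, and $D(n)=|\mathcal{D}_n|$ is the $n$-th Dedekind number. $\mathcal{D}_n$ is partially ordered by: $\alpha\le\beta$ iff for every $X\in\alpha$ there is $Y\in\beta$ with $X\subseteq Y$. Its smallest and largest elements are $\bot=\{\}$ and $\top=\{\{1,\dots,n\}\}$. For a set $S$ of subsets of $\mathcal{A}$, $\max(S)$ is the set of inclusion-maximal members of $S$. Join and meet are $\alpha\vee\beta=\max(\alpha\cup\beta)$ and $\alpha\wedge\beta=\max(\{X\cap Y: X\in\alpha, Y\in\beta\})$. The interval is $[\alpha,\beta]=\{\chi\in\mathcal{D}_n:\alpha\le\chi\le\beta\}$. *)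

(* Defs.v *)
From mathcomp Require Import all_boot.

Set Implicit Arguments.
Unset Strict Implicit.
Unset Printing Implicit Defensive.

(* The ground set {1, ..., n} is represented by 'I_n. *)

Definition antichain n (a : {set {set 'I_n}}) : bool :=
  [forall X in a, forall Y in a, (X \subset Y) ==> (X == Y)].

Definition antichains n : {set {set {set 'I_n}}} := [set a | antichain a].

Definition Dedekind (n : nat) : nat := #|antichains n|.

Definition ac_le n (a b : {set {set 'I_n}}) : bool :=
  [forall X in a, exists Y in b, X \subset Y].

Definition ac_bot n : {set {set 'I_n}} := set0.

Definition ac_top n : {set {set 'I_n}} := [set [set: 'I_n]].

Definition max_sets n (S : {set {set 'I_n}}) : {set {set 'I_n}} :=
  [set X | maxset (mem S) X].

Definition ac_join n (a b : {set {set 'I_n}}) : {set {set 'I_n}} :=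
  max_sets (a :|: b).

Definition ac_meet n (a b : {set {set 'I_n}}) : {set {set 'I_n}} :=
  max_sets [set X :&: Y | X in a, Y in b].

Definition ac_itv n (a b : {set {set 'I_n}}) : {set {set {set 'I_n}}} :=
  [set x in antichains n | ac_le a x && ac_le x b].

Definition P3 n (a b12 b13 b23 : {set {set 'I_n}}) : nat :=
  #|[set x : {set {set 'I_n}} * {set {set 'I_n}} * {set {set 'I_n}} |
      let: (x1, x2, x3) := x in
      [&& x1 \in antichains n, x2 \in antichains n, x3 \in antichains n,
          ac_meet (ac_meet x1 x2) x3 == a,
          ac_join x1 x2 == b12, ac_join x1 x3 == b13 & ac_join x2 x3 == b23]]|.

(* Main.v *)
Require Import Defs.
From mathcomp Require Import all_boot.

(** Antichains are encodings of down-sets, and [ac_le] is inclusion of the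
    down-sets they generate ([ac_leE]); hence [ac_join] and [ac_meet] obey the
    universal properties of suprema and infima ([ac_join_le], [ac_le_meet]).

    A down-set of subsets of an (n+1)-element set is the same as a pair [a <= b]
    of down-sets over n elements: [a] collects the members that contain the new
    element (with that element erased), [b] those that do not. The order on
    pairs is componentwise ([glue_le]), so doing this three times identifies an
    antichain over n + 3 elements with a monotone labelling of the vertices of
    a 3-cube by antichains over n elements ([Dedekind_cube]): a bottom [d],
    three vertices [x1], [x2], [x3] above it, three vertices [g12], [g13],
    [g23] above pairs of those, and a top [g].

    Fix [x1], [x2], [x3] and [g]. The other four labels are then chosen
    independently: [d] ranges over the interval below the meet of the [xi], and
    [gij] over the interval between the join of [xi] and [xj] and [g]. The
    number of choices depends on the [xi] only through their meet and their
    pairwise joins, so the triples can be grouped by these four antichains; the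
    number of triples in a group is [P3] ([sum_P3]). *)

Set Implicit Arguments.
Unset Strict Implicit.
Unset Printing Implicit Defensive.

(** * Antichains as down-sets *)

Section Order.
Variable n : nat.
Implicit Types (a b c S : {set {set 'I_n}}) (X Y : {set 'I_n}).

Definition down S : {set {set 'I_n}} := [set X : {set 'I_n} | [exists Y in S, X \subset Y]].

Lemma downP S X : reflect (exists2 Y, Y \in S & X \subset Y) (X \in down S).
Proof. by rewrite inE; apply: (iffP exists_inP). Qed.

Lemma down_closed S X Y : X \subset Y -> Y \in down S -> X \in down S.
Proof.
by move=> sXY /downP[Z SZ sYZ]; apply/downP; exists Z => //; apply: subset_trans sYZ.
Qed.

Lemma ac_leE a b : ac_le a b = (down a \subset down b).
Proof.
apply/forall_inP/subsetP=> [ab X /downP[Y aY sXY] | ab X aX].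
  by have /exists_inP/downP := ab Y aY; rewrite -/(down b) => bY; apply: down_closed bY.
by apply/exists_inP/downP/ab/downP; exists X.
Qed.

Lemma ac_le_refl a : ac_le a a.
Proof. by rewrite ac_leE. Qed.

Lemma ac_le_trans b a c : ac_le a b -> ac_le b c -> ac_le a c.
Proof. by rewrite !ac_leE; apply: subset_trans. Qed.

Lemma antichainP a :
  reflect {in a &, forall X Y, X \subset Y -> X = Y} (a \in antichains n).
Proof.
rewrite inE; apply: (iffP forall_inP) => [H X Y aX aY sXY | H X aX].
  by have /forall_inP/(_ Y aY)/implyP/(_ sXY)/eqP := H X aX.
by apply/forall_inP=> Y aY; apply/implyP=> sXY; apply/eqP/H.
Qed.

(** A member [X] of [a] lies below some [Y] in [b], which lies below some [Z] in
    [a]; then [X = Z] because [a] is an antichain, and so [X = Y]. *)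
Lemma down_inj : {in antichains n &, injective down}.
Proof.
have sub a b : a \in antichains n -> down a = down b -> a \subset b.
  move=> /antichainP aA eab; apply/subsetP=> X aX.
  have /downP[Y bY sXY] : X \in down b by rewrite -eab; apply/downP; exists X.
  have /downP[Z aZ sYZ] : Y \in down a by rewrite eab; apply/downP; exists Y.
  have eXZ := aA _ _ aX aZ (subset_trans sXY sYZ).
  by have -> : X = Y by apply/eqP; rewrite eqEsubset sXY eXZ sYZ.
by move=> a b aA bA eab; apply/eqP; rewrite eqEsubset !sub.
Qed.

Lemma max_sets_antichain S : max_sets S \in antichains n.
Proof.
apply/antichainP=> X Y; rewrite !inE => /maxsetP[_ maxX] /maxsetP[SY _] sXY.
by rewrite (maxX Y).
Qed.

(** Finiteness enters here: every member of [S] lies below a maximal one. *)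
Lemma down_max_sets S : down (max_sets S) = down S.
Proof.
apply/setP=> X; apply/downP/downP=> [[Y] | [Y SY sXY]].
  by rewrite inE => /maxsetp SY sXY; exists Y.
have [Z maxZ sYZ] := @maxset_exists _ (mem S) Y SY.
by exists Z; [rewrite inE | apply: subset_trans sYZ].
Qed.

Lemma down_max_sets_id S :
  (forall X Y, X \subset Y -> Y \in S -> X \in S) -> down (max_sets S) = S.
Proof.
move=> dS; rewrite down_max_sets; apply/setP=> X.
by apply/downP/idP=> [[Y SY sXY] | SX]; [apply: dS SY | exists X].
Qed.

Lemma down_join a b : down (ac_join a b) = down a :|: down b.
Proof.
rewrite down_max_sets; apply/setP=> X; rewrite !inE; apply/exists_inP/orP.
  by case=> Y; rewrite inE => /orP[aY|bY] sXY; [left|right]; apply/exists_inP; exists Y.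
by case=> /exists_inP[Y cY sXY]; exists Y => //; rewrite inE cY ?orbT.
Qed.

Lemma down_meet a b : down (ac_meet a b) = down a :&: down b.
Proof.
rewrite down_max_sets; apply/setP=> X; rewrite in_setI.
apply/downP/andP=> [[_ /imset2P[Y Z aY bZ ->]] | [/downP[Y aY sXY] /downP[Z bZ sXZ]]].
  by rewrite subsetI => /andP[sXY sXZ]; split; apply/downP; [exists Y|exists Z].
by exists (Y :&: Z); [apply: imset2_f | rewrite subsetI sXY].
Qed.

Lemma ac_join_le a b c : ac_le (ac_join a b) c = ac_le a c && ac_le b c.
Proof. by rewrite !ac_leE down_join subUset. Qed.

Lemma ac_le_meet a b c : ac_le c (ac_meet a b) = ac_le c a && ac_le c b.
Proof. by rewrite !ac_leE down_meet subsetI. Qed.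

Lemma ac_le_top a : ac_le a (ac_top n).
Proof.
by apply/forall_inP=> X _; apply/exists_inP; exists [set: 'I_n]; rewrite ?inE ?subsetT.
Qed.

Lemma ac_bot_le a : ac_le (ac_bot n) a.
Proof. by apply/forall_inP=> X; rewrite inE. Qed.

End Order.

(** * Adding one element to the ground set *)

Section Extend.
Variable n : nat.
Implicit Types (a b c : {set {set 'I_n}}) (x : {set {set 'I_n.+1}}).

Definition extend e (X : {set 'I_n}) : {set 'I_n.+1} :=
  [set i | if unlift ord_max i is Some j then j \in X else e].

Definition restrict (X : {set 'I_n.+1}) : {set 'I_n} :=
  [set j | lift ord_max j \in X].

Lemma extend_max e X : (ord_max \in extend e X) = e.
Proof. by rewrite inE unlift_none. Qed.

Lemma extendK e : cancel (extend e) restrict.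
Proof. by move=> X; apply/setP=> j; rewrite !inE liftK. Qed.

Lemma restrictK (X : {set 'I_n.+1}) : extend (ord_max \in X) (restrict X) = X.
Proof.
by apply/setP=> i; rewrite inE; case: unliftP => [j|] ->; rewrite ?inE.
Qed.

Lemma restrictS (X Y : {set 'I_n.+1}) : X \subset Y -> restrict X \subset restrict Y.
Proof. by move=> /subsetP sXY; apply/subsetP=> j; rewrite !inE => /sXY. Qed.

Lemma extendS e f (X Y : {set 'I_n}) : e ==> f -> X \subset Y -> extend e X \subset extend f Y.
Proof.
move=> /implyP ef /subsetP sXY; apply/subsetP=> i.
by rewrite !inE; case: unliftP => [j _ /sXY|].
Qed.

(** The antichain over [n.+1] elements whose down-set has [a] as its part
    containing [ord_max] and [b] as its part avoiding it; the set of which the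
    maximal members are taken is a down-set precisely when [ac_le a b]. *)
Definition glue a b : {set {set 'I_n.+1}} :=
  max_sets [set X : {set 'I_n.+1} | restrict X \in down (if ord_max \in X then a else b)].

(** The two components of the inverse of [glue]. *)
Definition section e x : {set {set 'I_n}} :=
  max_sets [set X : {set 'I_n} | extend e X \in down x].

Lemma mem_down_section e x X : (X \in down (section e x)) = (extend e X \in down x).
Proof.
rewrite down_max_sets_id ?in_set // => Y Z sYZ; rewrite [Z \in _]in_set [Y \in _]in_set.
exact: down_closed (extendS (implybb e) sYZ).
Qed.

Lemma section_le x : ac_le (section true x) (section false x).
Proof.
rewrite ac_leE; apply/subsetP=> X; rewrite !mem_down_section.
by apply: down_closed; apply: extendS.
Qed.

Lemma mem_down_glue a b (X : {set 'I_n.+1}) : ac_le a b ->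
  (X \in down (glue a b)) = (restrict X \in down (if ord_max \in X then a else b)).
Proof.
rewrite ac_leE => /subsetP ab.
rewrite down_max_sets_id ?in_set // => Y Z sYZ.
rewrite [Z \in _]in_set [Y \in _]in_set => dZ.
have := down_closed (restrictS sYZ) dZ; have := subsetP sYZ ord_max.
case: (_ \in Y); case: (_ \in Z) => // YZ; last exact: ab.
by have := YZ isT.
Qed.

Lemma sectionK x : x \in antichains n.+1 -> glue (section true x) (section false x) = x.
Proof.
move=> xA; apply: down_inj => //; first exact: max_sets_antichain.
apply/setP=> X; rewrite mem_down_glue ?section_le // -(fun_if (section^~ x)).
by rewrite mem_down_section -[in RHS](restrictK X); case: ifP.
Qed.

Lemma glueK a b e : a \in antichains n -> b \in antichains n -> ac_le a b ->
  section e (glue a b) = if e then a else b.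
Proof.
move=> aA bA ab; apply: down_inj; [exact: max_sets_antichain | by case: e |].
by apply/setP=> X; rewrite mem_down_section mem_down_glue // extend_max extendK.
Qed.

Lemma glue_le a b c d : ac_le a b -> ac_le c d ->
  ac_le (glue a b) (glue c d) = ac_le a c && ac_le b d.
Proof.
move=> ab cd; rewrite !ac_leE.
apply/subsetP/andP=> [H | [/subsetP ac /subsetP bd] X].
  have{}H e X : X \in down (if e then a else b) -> X \in down (if e then c else d).
    move=> dX; have: extend e X \in down (glue c d).
      by apply: H; rewrite mem_down_glue // extend_max extendK.
    by rewrite mem_down_glue // extend_max extendK.
  by split; apply/subsetP=> X; [apply: (H true) | apply: (H false)].
move=> dX; rewrite mem_down_glue //; rewrite mem_down_glue // in dX.
by case: (ord_max \in X) dX; [apply: ac | apply: bd].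
Qed.

Lemma sum_antichainsS (F : {set {set 'I_n.+1}} -> nat) :
  \sum_(x in antichains n.+1) F x =
  \sum_(a in antichains n) \sum_(b in antichains n | ac_le a b) F (glue a b).
Proof.
rewrite pair_big_dep /= (reindex_onto (fun p : _ * _ => glue p.1 p.2)
  (fun x => (section true x, section false x))) /=; last by move=> x /sectionK.
apply: eq_bigl => -[a b] /=; rewrite max_sets_antichain /=.
apply/eqP/and3P=> [[ea eb] | [aA bA ab]]; last by rewrite !glueK.
have aA : a \in antichains n by rewrite -ea; apply: max_sets_antichain.
have bA : b \in antichains n by rewrite -eb; apply: max_sets_antichain.
by split=> //; have := section_le (glue a b); rewrite ea eb.
Qed.

End Extend.

(** * The cube of antichains *)

(** The form in which the decomposition is iterated: as [glue_le] turns a lower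
    bound on [glue a b] into separate lower bounds on [a] and [b], the
    conditions met in the iteration split along [glue]. *)
Lemma sum_antichainsS_cond n (P : pred {set {set 'I_n.+1}})
    (P0 P1 : pred {set {set 'I_n}}) (F : {set {set 'I_n.+1}} -> nat) :
    (forall a b, ac_le a b -> P (glue a b) = P0 a && P1 b) ->
  \sum_(x in antichains n.+1 | P x) F x =
  \sum_(a in antichains n | P0 a) \sum_(b in antichains n | ac_le a b && P1 b)
    F (glue a b).
Proof.
move=> eP; rewrite big_mkcondr sum_antichainsS [RHS]big_mkcondr /=.
refine (eq_bigr _ _) => a _ /=; case: (boolP (P0 a)) => Pa; last first.
  by rewrite big1 // => b /andP[_ ab]; rewrite eP // (negbTE Pa).
rewrite big_mkcondr [RHS]big_mkcondr /=; apply: eq_bigr => b _.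
by case: (boolP (ac_le a b)) => //= ab; rewrite eP // Pa.
Qed.

(** Each label is constrained only by the lower covers of its vertex, so the
    conditions are the twelve edges of the cube. *)
Lemma Dedekind_cube n : Dedekind n.+3 =
  \sum_(d in antichains n) \sum_(x1 in antichains n | ac_le d x1)
  \sum_(x2 in antichains n | ac_le d x2)
  \sum_(g12 in antichains n | ac_le x2 g12 && ac_le x1 g12)
  \sum_(x3 in antichains n | ac_le d x3)
  \sum_(g13 in antichains n | ac_le x3 g13 && ac_le x1 g13)
  \sum_(g23 in antichains n | ac_le x3 g23 && ac_le x2 g23)
  \sum_(g in antichains n | [&& ac_le g23 g, ac_le g13 g & ac_le g12 g]) 1.
Proof.
rewrite /Dedekind -sum1_card !sum_antichainsS.
apply: eq_bigr => d _; apply: eq_bigr => x1 /andP[_ d_x1].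
rewrite (sum_antichainsS_cond (P0 := ac_le d) (P1 := ac_le x1)); last first.
  by move=> a b; apply: glue_le.
apply: eq_bigr => x2 /andP[_ d_x2]; apply: eq_bigr => g12 /and3P[_ x2_g12 x1_g12].
have le_glues : ac_le (glue d x1) (glue x2 g12) by rewrite glue_le // d_x2.
rewrite (sum_antichainsS_cond
  (P0 := ac_le (glue d x1)) (P1 := ac_le (glue x2 g12))); last first.
  by move=> a b; apply: glue_le.
rewrite (sum_antichainsS_cond (P0 := ac_le d) (P1 := ac_le x1)); last first.
  by move=> a b; apply: glue_le.
apply: eq_bigr => x3 _; apply: eq_bigr => g13 /and3P[_ x3_g13 _].
rewrite (sum_antichainsS_cond (P0 := fun g23 => ac_le x3 g23 && ac_le x2 g23)
  (P1 := fun g => ac_le g13 g && ac_le g12 g)) // => a b ab.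
by rewrite !glue_le // andbACA.
Qed.

(** * Grouping triples by their meet and joins *)

Lemma mem_itv n (a b x : {set {set 'I_n}}) :
  (x \in ac_itv a b) = [&& x \in antichains n, ac_le a x & ac_le x b].
Proof. by rewrite in_set. Qed.

Lemma ac_meet_antichain n (a b : {set {set 'I_n}}) : ac_meet a b \in antichains n.
Proof. exact: max_sets_antichain. Qed.

Lemma ac_join_antichain n (a b : {set {set 'I_n}}) : ac_join a b \in antichains n.
Proof. exact: max_sets_antichain. Qed.

Definition meet_joins n (x : {set {set 'I_n}} * {set {set 'I_n}} * {set {set 'I_n}}) :=
  let: (x1, x2, x3) := x in
  (ac_meet (ac_meet x1 x2) x3, ac_join x1 x2, ac_join x1 x3, ac_join x2 x3).

Lemma ac_join_itv n (a x y : {set {set 'I_n}}) :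
  ac_le a x -> ac_join x y \in ac_itv a (ac_top n).
Proof.
move=> ax; rewrite mem_itv ac_join_antichain ac_le_top andbT /=.
apply: ac_le_trans ax _.
by have := ac_le_refl (ac_join x y); rewrite ac_join_le => /andP[].
Qed.

(** [P3] is the cardinality of the fibres of [meet_joins]; those fibres cover all
    triples because the joins lie above the meet. *)
Lemma sum_P3 n (W : _ -> _ -> _ -> _ -> nat) :
  \sum_(a in antichains n)
   \sum_(b12 in ac_itv a (ac_top n))
    \sum_(b13 in ac_itv a (ac_top n))
     \sum_(b23 in ac_itv a (ac_top n)) P3 a b12 b13 b23 * W a b12 b13 b23 =
  \sum_(x1 in antichains n) \sum_(x2 in antichains n) \sum_(x3 in antichains n)
   W (ac_meet (ac_meet x1 x2) x3) (ac_join x1 x2) (ac_join x1 x3) (ac_join x2 x3).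
Proof.
rewrite !pair_big_dep /=.
rewrite [RHS](partition_big (@meet_joins n) (fun p =>
  [&& p.1.1.1 \in antichains n, p.1.1.2 \in ac_itv p.1.1.1 (ac_top n),
      p.1.2 \in ac_itv p.1.1.1 (ac_top n) & p.2 \in ac_itv p.1.1.1 (ac_top n)])) /=.
  apply: eq_big => [p|]; first by rewrite !andbA.
  move=> [[[a b12] b13] b23] _ /=; rewrite /P3 -sum_nat_const.
  apply: eq_big => [[[x1 x2] x3]|[[x1 x2] x3]]; rewrite [_ \in [set _ | _]]in_set.
    by rewrite !xpair_eqE -!andbA.
  by case/and5P=> _ _ _ /eqP-> /and3P[/eqP-> /eqP-> /eqP->].
move=> [[x1 x2] x3] _ /=; rewrite ac_meet_antichain.
have := ac_le_refl (ac_meet (ac_meet x1 x2) x3).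
by rewrite !ac_le_meet => /andP[/andP[m1 m2] _]; rewrite !ac_join_itv.
Qed.

Theorem theorem9p1 (n : nat) :
  Dedekind (n + 3) =
  \sum_(a in antichains n)
   \sum_(b12 in ac_itv a (ac_top n))
    \sum_(b13 in ac_itv a (ac_top n))
     \sum_(b23 in ac_itv a (ac_top n))
      \sum_(g in ac_itv (ac_join (ac_join b12 b13) b23) (ac_top n))
        P3 a b12 b13 b23 * #|ac_itv (ac_bot n) a| *
        #|ac_itv b12 g| * #|ac_itv b13 g| * #|ac_itv b23 g|.
Proof.
rewrite addn3 Dedekind_cube; under [RHS]eq_bigr => a _ do
  under eq_bigr => b12 _ do under eq_bigr => b13 _ do under eq_bigr => b23 _ do
  (under eq_bigr => g _ do rewrite -!mulnA; rewrite -big_distrr /=).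
rewrite sum_P3; under [RHS]eq_bigr => x1 _ do
  under eq_bigr => x2 _ do under eq_bigr => x3 _ do under eq_bigr => g _ do
  rewrite -!cardsX -sum1_card.
(* Both sides count the labellings of the cube, with the vertices listed in
   different orders. *)
rewrite !pair_big_dep /=.
rewrite (reindex (fun q : _ * _ * _ * _ * (_ * (_ * (_ * _))) =>
  let: (x1, x2, x3, g, (d, (g12, (g13, g23)))) := q in
  (d, x1, x2, g12, x3, g13, g23, g))) /=; last first.
  exists (fun p => let: (d, x1, x2, g12, x3, g13, g23, g) := p in
            (x1, x2, x3, g, (d, (g12, (g13, g23))))).
    by move=> [[[[? ?] ?] ?] [? [? [? ?]]]].
  by move=> [[[[[[[? ?] ?] ?] ?] ?] ?] ?].
apply: eq_bigl => -[[[[x1 x2] x3] g] [d [g12 [g13 g23]]]] /=.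
rewrite !in_setX !mem_itv !ac_join_le !ac_le_meet ac_le_top ac_bot_le andbT /=.
apply/idP/idP; rewrite -!andbA; do ![case/andP=> ?]; move=> ?; last first.
  by do ![apply/andP; split].
(* The bound of [g] below by all joins follows by transitivity through the [gij]. *)
have x1_g : ac_le x1 g by apply: (@ac_le_trans _ g12).
have x2_g : ac_le x2 g by apply: (@ac_le_trans _ g12).
have x3_g : ac_le x3 g by apply: (@ac_le_trans _ g13).
by do ![apply/andP; split].
Qed.
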